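(* Let $q$ be a prime power, $P \in \mathbb{F}_q[x]$ an irreducible polynomial, $k \geq 1$, and $D \subset \mathrm{Div}(P^k)$ with $P^k \notin D$. Suppose that $G_{P^k}(D)$ is connected. Then $G_{P^k}(D)$ is a bipartite graph if and only if the following conditions hold: (1) $\mathbb{F}_q = \mathbb{F}_2$; (2) $\deg(P) = 1$, namely either $P = x$ or $P = x+1$; (3) $D = \{1\}$.
   Context: For a nonconstant $f \in \mathbb{F}_q[x]$, $\mathrm{Div}(f)$ is the set of divisors of $f$ up to multiplication by nonzero constants; for $D \subset \mathrm{Div}(f)$ with $f \notin D$, the gcd-graph $G_f(D)$ is the simple undirected graph with vertex set $\mathbb{F}_q[x]/f$ in which $a,b$ are adjacent iff $\gcd(a-b,f) \in D$ (gcd taken up to nonzero constants). *)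

(* Defs.v *)
From HB Require Import structures.
From mathcomp Require Import all_boot all_order all_algebra all_field.

Set Implicit Arguments.
Unset Strict Implicit.
Unset Printing Implicit Defensive.

Import GRing.Theory.
Local Open Scope ring_scope.
Local Open Scope quotient_scope.

Section Assoc.
Variable F : fieldType.

Canonical eqp_equiv_rel :=
  EquivRel (@eqp F) (@eqpxx F) (@eqp_sym F) (@eqp_trans F).

(* Polynomials up to multiplication by a nonzero constant. *)
Definition assoc_poly : choiceType := {eq_quot (@eqp F)}.

Definition assoc (p : {poly F}) : assoc_poly := \pi_({eq_quot (@eqp F)}) p.

Lemma assocP p q : reflect (assoc p = assoc q) (p %= q).
Proof. exact: eqmodP. Qed.

Definition Div (f : {poly F}) : {pred assoc_poly} :=
  [pred c | repr (c : {eq_quot (@eqp F)}) %| f].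

Lemma Div_assoc f p : (assoc p \in Div f) = (p %| f).
Proof.
rewrite inE; apply: eqp_dvdl; apply/assocP.
by rewrite /assoc reprK.
Qed.

(* [{poly %/ h}] is the quotient by (h) only when h is monic (and otherwise
   silently a quotient by ('X)), hence the normalization: it generates the same
   ideal as f. *)
Definition monic_normal (f : {poly F}) : {poly F} := (lead_coef f)^-1 *: f.

Lemma monic_normal_eqp (f : {poly F}) : f != 0 -> monic_normal f %= f.
Proof. by move=> f0; rewrite eqp_scale // invr_eq0 lead_coef_eq0. Qed.

Lemma mk_monic_normal (f : {poly F}) :
  (1 < size f)%N -> mk_monic (monic_normal f) = monic_normal f.
Proof.
move=> sf; have f0 : f != 0 by rewrite -size_poly_gt0 ltnW.
rewrite /mk_monic (eqp_size (monic_normal_eqp f0)) sf /=.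
by rewrite /monic_normal monicE lead_coefZ mulVf ?lead_coef_eq0 ?eqxx.
Qed.

End Assoc.

(* Vertices are coerced to their reduced representative.  The choice of
   representatives is immaterial: see [gcd_graph_in_qpoly]. *)
Definition gcd_graph (F : finFieldType) (f : {poly F})
    (D : {pred assoc_poly F}) : rel {poly %/ monic_normal f} :=
  fun a b => assoc (gcdp (a - b) f) \in D.
Arguments gcd_graph {F} f D a b.

Section GcdGraph.
Variables (F : finFieldType) (f : {poly F}) (D : {pred assoc_poly F}).

Lemma gcd_graph_sym : symmetric (gcd_graph f D).
Proof.
move=> a b; rewrite /gcd_graph; congr (_ \in D); apply/assocP.
apply: eqp_gcdl; rewrite -[a - b]opprB.
have -> : polyn (- (b - a)) = - polyn (b - a) by [].
by rewrite -scaleN1r eqp_scale // oppr_eq0 oner_eq0.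
Qed.

Lemma gcd_graph_irr : assoc f \notin D -> irreflexive (gcd_graph f D).
Proof. by move=> fD a; rewrite /gcd_graph subrr gcd0p; apply: negbTE. Qed.

Lemma gcd_graph_in_qpoly (p q : {poly F}) : (1 < size f)%N ->
  gcd_graph f D (in_qpoly (monic_normal f) p) (in_qpoly (monic_normal f) q)
    = (assoc (gcdp (p - q) f) \in D).
Proof.
move=> sf; have f0 : f != 0 by rewrite -size_poly_gt0 ltnW.
rewrite /gcd_graph; congr (_ \in D); apply/assocP.
have mf : monic_normal f \is monic.
  by rewrite monicE lead_coefZ mulVf ?lead_coef_eq0.
have -> : in_qpoly (monic_normal f) p - in_qpoly (monic_normal f) q
    = in_qpoly (monic_normal f) (p - q) by rewrite raddfB.
rewrite /= mk_monic_normal // -Pdiv.IdomainMonic.modpE //.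
apply: eqp_trans (gcdpC _ _) _.
set m := monic_normal f; have mE : m %= f by exact: monic_normal_eqp.
apply: (eqp_trans (y := gcdp m ((p - q) %% m))).
  by apply: eqp_gcdl; rewrite eqp_sym.
apply: eqp_trans (gcdp_modr _ _) _.
by apply: eqp_trans (eqp_gcdl _ mE) (gcdpC _ _).
Qed.

End GcdGraph.

Definition connected (T : finType) (e : rel T) : Prop :=
  forall x y : T, connect e x y.

Definition bipartite (T : finType) (e : rel T) : Prop :=
  exists A B : {set T},
    [/\ A :|: B = [set: T], [disjoint A & B],
        {in A &, forall x y, ~~ e x y} & {in B &, forall x y, ~~ e x y}].

(* Main.v *)
(** The graph is connected only if some edge joins vertices that differ modulo
    [P], that is, only if [1 \in D]; then all pairs that differ modulo [P] are
    adjacent.  If the residue field has an element [c] other than [0] and [1],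
    the vertices [0, 1, c] form a triangle; if [D] has an element [r] other than
    [1], then [P] divides [r] and [0, 1, r] is a triangle.  Conversely, over
    [F_2] with [P] linear and [D = {1}], the two classes modulo [P] are
    independent. *)
Require Import Defs.
From mathcomp Require Import all_boot all_order all_algebra all_field.
Set Implicit Arguments.
Unset Strict Implicit.
Unset Printing Implicit Defensive.

Import GRing.Theory.
Local Open Scope ring_scope.

(** Both neighbours of [x] lie in the part opposite to [x], yet they are adjacent. *)
Lemma bipartite_triangle_free (T : finType) (e : rel T) (x y z : T) :
  bipartite e -> e x y -> e y z -> e x z -> False.
Proof.
move=> [A [B [AB _ indA indB]]] exy eyz exz.
have inAB t : (t \in A) || (t \in B) by rewrite -in_setU AB in_setT.
have nA u v : e u v -> u \in A -> v \in B.
  move=> euv uA; have /orP[vA|//] := inAB v.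
  by have := indA u v uA vA; rewrite euv.
have nB u v : e u v -> u \in B -> v \in A.
  move=> euv uB; have /orP[//|vB] := inAB v.
  by have := indB u v uB vB; rewrite euv.
have /orP[xA|xB] := inAB x.
  by have := indB y z (nA _ _ exy xA) (nA _ _ exz xA); rewrite eyz.
by have := indA y z (nB _ _ exy xB) (nB _ _ exz xB); rewrite eyz.
Qed.

Lemma card_eq2_zero_one (F : finFieldType) :
  (#|F| == 2%N) = [forall c : F, (c == 0) || (c == 1)].
Proof.
have c2 : #|pred2 (0 : F) 1| = 2%N by rewrite card2 eq_sym oner_eq0.
apply/idP/forallP => [/eqP cF c | h].
  have /subset_cardP h : #|pred2 (0 : F) 1| = #|F| by rewrite c2 cF.
  by have := h (subset_predT _) c; rewrite !inE.
rewrite -c2; apply/eqP/eq_card => c; rewrite !inE.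
by rewrite (h c).
Qed.

Section PrimePower.
Variables (F : finFieldType) (P : {poly F}) (k : nat) (D : {pred assoc_poly F}).
Hypotheses (irrP : irreducible_poly P) (k_gt0 : (0 < k)%N).

Let vertex (p : {poly F}) := in_qpoly (monic_normal (P ^+ k)) p.

Let coprimepP p : coprimep p P = ~~ (P %| p).
Proof. by rewrite coprimep_sym irreducible_poly_coprime. Qed.

Let size_Pk : (1 < size (P ^+ k))%N.
Proof.
have [sP _] := irrP; rewrite -subn_gt0 subn1 size_exp muln_gt0 k_gt0 andbT.
by rewrite -subn1 subn_gt0.
Qed.

(** As [P] is irreducible, being coprime to [P ^+ k] with [k > 0] is the same as being coprime to
    [P]. *)
Lemma assoc_gcdp_exp_eq1 (p : {poly F}) :
  (assoc (gcdp p (P ^+ k)) == assoc 1) = ~~ (P %| p).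
Proof.
have -> : (assoc (gcdp p (P ^+ k)) == assoc 1) = coprimep p (P ^+ k).
  by rewrite -gcdp_eqp1; apply/eqP/idP => /assocP.
by rewrite coprimep_pexpr // coprimepP.
Qed.

Lemma gcd_graph_of_ndvdp (p q : {poly F}) :
  assoc 1 \in D -> ~~ (P %| p - q) -> gcd_graph (P ^+ k) D (vertex p) (vertex q).
Proof.
move=> D1 nPpq; rewrite gcd_graph_in_qpoly //.
by move: nPpq; rewrite -assoc_gcdp_exp_eq1 => /eqP ->.
Qed.

(** Without the class of 1 in [D], each edge, hence each path, preserves residues modulo [P]; a path
    from 1 to 0 would make [P] divide 1. *)
Lemma connected_gcd_graph_exp_one :
  connected (gcd_graph (P ^+ k) D) -> assoc 1 \in D.
Proof.
move=> conn; apply/negPn/negP => D1.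
have edgeP a b : gcd_graph (P ^+ k) D a b -> P %| polyn a - polyn b.
  move=> eab; apply/negPn/negP; rewrite -assoc_gcdp_exp_eq1 => /eqP E.
  by move: eab; rewrite /gcd_graph /= E (negbTE D1).
have dvdPath a s : path (gcd_graph (P ^+ k) D) a s ->
    P %| polyn a - polyn (last a s).
  elim: s a => [a _|b s IH a] /=; first by rewrite subrr dvdp0.
  move=> /andP[/edgeP ab /IH bs].
  by rewrite -(subrKA (polyn b)) dvdp_add.
have /connectP[s /dvdPath Ps ls] := conn 1 0.
move: Ps; rewrite -ls /= subr0 dvdp1.
by have [/gtn_eqF-> _] := irrP.
Qed.

(** Otherwise [P] divides none of the differences [c - 1], [1] and [c], so [c], 1, 0 form a
    triangle. *)
Lemma bipartite_gcd_graph_exp_residue (c : {poly F}) : assoc 1 \in D ->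
  bipartite (gcd_graph (P ^+ k) D) -> (P %| c) || (P %| c - 1).
Proof.
move=> D1 bip; apply/negPn/negP; rewrite negb_or => /andP[nc nc1].
apply: (bipartite_triangle_free (x := vertex c) (y := vertex 1) (z := vertex 0) bip);
  apply: gcd_graph_of_ndvdp; rewrite ?subr0 //.
by rewrite dvdp1; have [/gtn_eqF-> _] := irrP.
Qed.

Lemma bipartite_gcd_graph_exp_generators : {subset D <= Div (P ^+ k)} ->
  assoc 1 \in D -> bipartite (gcd_graph (P ^+ k) D) -> D =i pred1 (assoc 1).
Proof.
move=> subD D1 bip d; rewrite inE; apply/idP/eqP => [dD|-> //].
apply/eqP/negPn/negP => d1.
set r := generic_quotient.repr d; have dE : assoc r = d by rewrite /assoc reprK.
have rPk : r %| P ^+ k by rewrite -Div_assoc dE subD.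
have gr : assoc (gcdp r (P ^+ k)) = d.
  by rewrite -dE; apply/assocP; apply: dvdp_gcd_idl.
(* If [P] did not divide [r], the gcd of [r] with [P ^+ k], which is [r] itself, would be trivial,
   against [d1]. *)
have Pr : P %| r by apply/negPn; rewrite -assoc_gcdp_exp_eq1 gr.
have nP1 : ~~ (P %| 1) by rewrite dvdp1; have [/gtn_eqF-> _] := irrP.
apply: (bipartite_triangle_free (x := vertex 1) (y := vertex r) (z := vertex 0) bip).
- by apply: gcd_graph_of_ndvdp => //; rewrite dvdp_subl.
- by rewrite gcd_graph_in_qpoly // subr0 gr.
- by apply: gcd_graph_of_ndvdp => //; rewrite subr0.
Qed.

Lemma bipartite_gcd_graph_exp_linear : (forall c : F, (c == 0) || (c == 1)) ->
  size P = 2%N -> D =i pred1 (assoc 1) -> bipartite (gcd_graph (P ^+ k) D).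
Proof.
(* Evaluation at the root [x] of [P] computes residues modulo [P]; its two possible values give the
   two parts. *)
move=> F2 sP D1; have [x rPx] := poly2_root sP.
have Px : P %= 'X - x%:P.
  by rewrite eqp_sym -dvdp_size_eqp ?dvdp_XsubCl // size_XsubC sP.
have indep a b : (polyn a).[x] = (polyn b).[x] -> ~~ gcd_graph (P ^+ k) D a b.
  move=> ab; rewrite /gcd_graph D1 inE assoc_gcdp_exp_eq1 negbK.
  by rewrite (eqp_dvdl _ Px) dvdp_XsubCl rootE /= hornerD hornerN ab subrr.
pose A := [set a : {poly %/ monic_normal (P ^+ k)} | (polyn a).[x] == 0].
exists A, (~: A); split; first exact: setUCr.
- by rewrite -setI_eq0 setICr.
- by move=> a b; rewrite !inE => /eqP a0 /eqP b0; apply: indep; rewrite a0 b0.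
- move=> a b; rewrite !inE => a0 b0; apply: indep.
  (* Outside [A] the value at [x] is nonzero, hence 1. *)
  have := F2 (polyn a).[x]; have := F2 (polyn b).[x].
  by rewrite (negbTE a0) (negbTE b0) => /eqP-> /eqP->.
Qed.

End PrimePower.

(** The leading coefficient is nonzero, hence 1; only the constant term remains free. *)
Lemma linear_poly_F2 (F : finFieldType) (P : {poly F}) :
  (forall c : F, (c == 0) || (c == 1)) -> size P = 2%N ->
  P = 'X \/ P = 'X + 1.
Proof.
move=> F2 sP; have P1 : P`_1 = 1.
  have : lead_coef P != 0 by rewrite lead_coef_eq0 -size_poly_gt0 sP.
  by rewrite lead_coefE sP /=; case/orP: (F2 P`_1) => /eqP-> //; rewrite eqxx.
have PE : P = 'X + (P`_0)%:P.
  apply/polyP => -[|[|i]]; rewrite coefD coefX coefC ?add0r ?addr0 //=.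
  by rewrite nth_default // sP.
by rewrite PE; case/orP: (F2 P`_0) => /eqP->; [left; rewrite addr0 | right].
Qed.

Theorem proposition3p2 (F : finFieldType) (P : {poly F}) (k : nat)
    (D : {pred assoc_poly F}) :
  irreducible_poly P ->
  (1 <= k)%N ->
  {subset D <= Div (P ^+ k)} ->
  assoc (P ^+ k) \notin D ->
  connected (gcd_graph (P ^+ k) D) ->
  (bipartite (gcd_graph (P ^+ k) D) <->
   [/\ #|F| = 2%N,
       size P = 2%N /\ (P = 'X \/ P = 'X + 1) &
       D =i pred1 (assoc (1 : {poly F}))]).
Proof.
move=> irrP k_gt0 subD _ conn.
split=> [bip | [/eqP F2 [sP _] D1]]; last first.
  rewrite card_eq2_zero_one in F2.
  by apply: bipartite_gcd_graph_exp_linear => //; apply/forallP.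
have D1 := connected_gcd_graph_exp_one irrP k_gt0 conn.
have [sP _] := irrP.
have res c := bipartite_gcd_graph_exp_residue irrP k_gt0 c D1 bip.
(* For polynomials of degree below that of [P], this turns the congruences in [res] into
   equalities. *)
have small (p : {poly F}) : (size p < size P)%N -> (P %| p) = (p == 0).
  move=> sp; apply/idP/eqP => [Pp|-> //]; apply/eqP/negPn/negP => p0.
  by have := dvdp_leq p0 Pp; rewrite leqNgt sp.
have F2 (c : F) : (c == 0) || (c == 1).
  have := res c%:P; rewrite -polyCB !small ?(leq_ltn_trans (size_polyC_leq1 _)) //.
  by rewrite !polyC_eq0 subr_eq0.
(* If [P] had degree at least 2, then ['X] would be a residue other than 0 and 1. *)
have sP2 : size P = 2%N.
  apply/eqP; rewrite eqn_leq sP andbT leqNgt; apply/negP => sP3.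
  have := res 'X; rewrite -polyC1 !small ?size_XsubC ?size_polyX //.
  by rewrite polyX_eq0 polyXsubC_eq0.
split; first by apply/eqP; rewrite card_eq2_zero_one; apply/forallP.
- by split=> //; apply: linear_poly_F2.
- exact: bipartite_gcd_graph_exp_generators irrP k_gt0 subD D1 bip.
Qed.
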